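(* Let $N\ge 2$ and consider $N$ agents with discrete-time double-integrator dynamics $$p_i^{(k+1)}=p_i^{(k)}+v_i^{(k)},\qquad v_i^{(k+1)}=v_i^{(k)}+u_i^{(k)},\qquad i=1,\dots,N,\ k=0,1,2,\dots,$$ with $p_i^{(k)},v_i^{(k)}\in\mathbb{R}$, under the control law $$u_i^{(k)}=\gamma_1\sum_{j=1}^N a_{ij}^{(k)}\big(p_j^{(k)}-p_i^{(k)}\big)+\gamma_2\sum_{j=1}^N a_{ij}^{(k)}\big(v_j^{(k)}-v_i^{(k)}\big),$$ where for each $k$ the matrix $\mathcal{A}^{(k)}=(a_{ij}^{(k)})$ is a real symmetric $N\times N$ matrix with nonnegative entries and zero diagonal. Equivalently, with $x^{(k)}=((p^{(k)})^\top,(v^{(k)})^\top)^\top$, $x^{(k+1)}=F^{(k)}x^{(k)}$ where $F^{(k)}=\begin{pmatrix} I_N & I_N\\ -\gamma_1L^{(k)} & I_N-\gamma_2L^{(k)}\end{pmatrix}$ and $L^{(k)}$ is the Laplacian of $\mathcal{A}^{(k)}$. Assume the undirected graph with adjacency matrix $\mathcal{A}^{(0)}$ is connected, and that $$\gamma_2>\gamma_1>0,\qquad \gamma_1-2\gamma_2>-\frac{4}{\mu_i^{(0)}}\ \text{ for every nonzero eigenvalue }\mu_i^{(0)}\text{ of }L^{(0)}.$$ Then there exists $\delta_A>0$ such that, whenever $\|\mathcal{A}^{(k)}-\mathcal{A}^{(0)}\|_{\max}<\delta_A$ for all $k\ge 0$ (where $\|M\|_{\max}=\max_{i,j}|M_{ij}|$),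 the agents reach consensus for every initial condition, i.e. $\lim_{k\to\infty}(p_i^{(k)}-p_j^{(k)})=0$ and $\lim_{k\to\infty}(v_i^{(k)}-v_j^{(k)})=0$ for all $i,j$.
   Context: The Laplacian $L=(l_{ij})$ of a symmetric nonnegative matrix $\mathcal{A}=(a_{ij})$ with zero diagonal is defined by $l_{ij}=-a_{ij}$ for $i\ne j$ and $l_{ii}=\sum_{j\ne i}a_{ij}$. The graph associated with $\mathcal{A}$ has an edge between $i$ and $j$ iff $a_{ij}>0$. The sampling time is normalized to $1$. *)

(* Defs.v *)
From Stdlib Require Export Reals Relations.
Open Scope R_scope.

(* Agents / matrix indices are 0..N-1; an N x N real matrix is a function
   nat -> nat -> R, only its entries with indices < N are meaningful. *)

Fixpoint sumN (n : nat) (f : nat -> R) : R :=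
  match n with
  | O => 0
  | S m => sumN m f + f m
  end.

Definition valid_adj (N : nat) (A : nat -> nat -> R) : Prop :=
  forall i j, (i < N)%nat -> (j < N)%nat ->
    A i j = A j i /\ 0 <= A i j /\ A i i = 0.

Definition laplacian (N : nat) (A : nat -> nat -> R) (i j : nat) : R :=
  if Nat.eqb i j
  then sumN N (fun l => if Nat.eqb l i then 0 else A i l)
  else - A i j.

Definition is_eigenvalue (N : nat) (M : nat -> nat -> R) (mu : R) : Prop :=
  exists x : nat -> R,
    (exists i, (i < N)%nat /\ x i <> 0) /\
    forall i, (i < N)%nat -> sumN N (fun j => M i j * x j) = mu * x i.

Definition adj_edge (N : nat) (A : nat -> nat -> R) (i j : nat) : Prop :=
  (i < N)%nat /\ (j < N)%nat /\ A i j > 0.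

Definition graph_connected (N : nat) (A : nat -> nat -> R) : Prop :=
  forall i j, (i < N)%nat -> (j < N)%nat ->
    clos_refl_trans nat (adj_edge N A) i j.

Definition control (N : nat) (g1 g2 : R) (A : nat -> nat -> R)
  (p v : nat -> R) (i : nat) : R :=
  g1 * sumN N (fun j => A i j * (p j - p i))
  + g2 * sumN N (fun j => A i j * (v j - v i)).

(* Main.v *)
Require Import Defs.
From Stdlib Require Import Reals Lra Lia Arith FunctionalExtensionality.
Open Scope R_scope.

(** Remove the averages, put [m = p + v/2], [s = v + v'], [h = g2 - g1/2],
    [K = I - (h/2) L] with [L] the Laplacian at time 0. Then [m' = m + s/2],
    [v' = s - v] and [s = 2 K v - g1 L m + e], where [e] is the effect of the
    perturbation of [L]. The energy [<v,Kv> + g1 <m,Lm>] changes by exactly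
    [<s,e> - ((g2-g1)/2) <s,Ls>]; adding a small multiple of [<m,Kv>] makes the
    decrease strict in both [m] and [v], with room to absorb [e]. The eigenvalue
    condition says that no eigenvalue of [L] reaches [2/h], i.e. that [K] is
    positive definite, and connectedness makes [L] coercive on mean-free vectors. *)

(** * Finite sums *)

Lemma sumN_ext n f g : (forall i, (i < n)%nat -> f i = g i) -> sumN n f = sumN n g.
Proof.
  induction n as [|n IH]; simpl; intros H; [reflexivity|].
  rewrite IH by (intros; apply H; lia). rewrite H by lia. reflexivity.
Qed.

Lemma sumN_linear n a b f g :
  sumN n (fun i => a * f i + b * g i) = a * sumN n f + b * sumN n g.
Proof. induction n as [|n IH]; simpl; [ring|rewrite IH; ring]. Qed.

Lemma sumN_plus n f g : sumN n (fun i => f i + g i) = sumN n f + sumN n g.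
Proof. induction n as [|n IH]; simpl; [ring|rewrite IH; ring]. Qed.

Lemma sumN_scal n a f : sumN n (fun i => a * f i) = a * sumN n f.
Proof. induction n as [|n IH]; simpl; [ring|rewrite IH; ring]. Qed.

Lemma sumN_const n a : sumN n (fun _ => a) = INR n * a.
Proof. induction n as [|n IH]; [simpl; ring|]. rewrite S_INR; simpl; rewrite IH; ring. Qed.

Lemma sumN_le n f g :
  (forall i, (i < n)%nat -> f i <= g i) -> sumN n f <= sumN n g.
Proof.
  induction n as [|n IH]; simpl; intros H; [lra|].
  apply Rplus_le_compat; [apply IH; intros; apply H; lia|apply H; lia].
Qed.

Lemma sumN_nonneg n f : (forall i, (i < n)%nat -> 0 <= f i) -> 0 <= sumN n f.
Proof.
  intros H. replace 0 with (sumN n (fun _ => 0)) by (rewrite sumN_const; ring).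
  now apply sumN_le.
Qed.

Lemma sumN_term_le n f i :
  (forall j, (j < n)%nat -> 0 <= f j) -> (i < n)%nat -> f i <= sumN n f.
Proof.
  induction n as [|n IH]; intros H Hi; [lia|]; simpl.
  assert (0 <= f n) by (apply H; lia).
  assert (0 <= sumN n f) by (apply sumN_nonneg; intros; apply H; lia).
  destruct (Nat.eq_dec i n) as [->|]; [lra|].
  assert (f i <= sumN n f) by (apply IH; [intros; apply H; lia|lia]). lra.
Qed.

Lemma sumN_swap n m f :
  sumN n (fun i => sumN m (fun j => f i j)) = sumN m (fun j => sumN n (fun i => f i j)).
Proof.
  induction n as [|n IH]; simpl.
  - rewrite sumN_const; ring.
  - rewrite IH, sumN_plus. reflexivity.
Qed.

Lemma sumN_delta n i f :
  (i < n)%nat -> sumN n (fun j => if Nat.eqb i j then f j else 0) = f i.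
Proof.
  induction n as [|n IH]; intros Hi; [lia|]; simpl.
  destruct (Nat.eqb_spec i n) as [->|].
  - rewrite (sumN_ext n _ (fun _ => 0)), sumN_const; [ring|].
    intros j Hj. destruct (Nat.eqb_spec n j); [lia|reflexivity].
  - rewrite IH by lia. ring.
Qed.

(** * Inner product and linear combinations of vectors *)

Definition dot (n : nat) (x y : nat -> R) : R := sumN n (fun i => x i * y i).

Definition lincomb (a : R) (x : nat -> R) (b : R) (y : nat -> R) : nat -> R :=
  fun i => a * x i + b * y i.

Lemma dot_sym n x y : dot n x y = dot n y x.
Proof. apply sumN_ext; intros; ring. Qed.

Lemma dot_lincomb_l n a x b y z :
  dot n (lincomb a x b y) z = a * dot n x z + b * dot n y z.
Proof.
  unfold dot. rewrite <- sumN_linear.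
  apply sumN_ext; intros; unfold lincomb; ring.
Qed.

Lemma dot_lincomb_r n a x b y z :
  dot n z (lincomb a x b y) = a * dot n z x + b * dot n z y.
Proof. rewrite dot_sym, dot_lincomb_l, !(dot_sym n z). reflexivity. Qed.

Lemma dot_self_nonneg n x : 0 <= dot n x x.
Proof. apply sumN_nonneg; intros; nra. Qed.

Lemma dot_self_pos n x i : (i < n)%nat -> x i <> 0 -> 0 < dot n x x.
Proof.
  intros Hi Hx. apply Rlt_le_trans with (x i * x i); [nra|].
  apply (sumN_term_le n (fun i => x i * x i)); [intros; nra|assumption].
Qed.

Lemma dot_self_eq0 n x : dot n x x = 0 -> forall i, (i < n)%nat -> x i = 0.
Proof.
  intros H i Hi. destruct (Req_dec (x i) 0) as [|Hx]; [assumption|].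
  pose proof (dot_self_pos n x i Hi Hx). lra.
Qed.

Lemma dot_ext n x x' y y' :
  (forall i, (i < n)%nat -> x i = x' i) -> (forall i, (i < n)%nat -> y i = y' i) ->
  dot n x y = dot n x' y'.
Proof. intros Hx Hy; apply sumN_ext; intros; rewrite Hx, Hy; auto. Qed.

(** Expand the squared norm of [x - t/(2w) y] and multiply by [w]. The sign of [t] is free, so the
    lemma also serves for terms with a negative coefficient. *)
Lemma young n t w x y : 0 < w -> t * dot n x y <= w * dot n x x + t * t / (4 * w) * dot n y y.
Proof.
  intros Hw. pose proof (dot_self_nonneg n (lincomb 1 x (- (t / (2 * w))) y)) as H.
  rewrite !dot_lincomb_l, !dot_lincomb_r, (dot_sym n y x) in H.
  apply Rmult_le_compat_l with (r := w) in H; [|lra].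
  assert (E : w * 0 = 0) by ring. rewrite E in H.
  assert (E2 : w * (1 * (1 * dot n x x + - (t / (2 * w)) * dot n x y) +
     - (t / (2 * w)) * (1 * dot n x y + - (t / (2 * w)) * dot n y y))
     = w * dot n x x - t * dot n x y + t * t / (4 * w) * dot n y y) by (field; lra).
  rewrite E2 in H. lra.
Qed.

(** * Quadratic forms: coercivity and the largest eigenvalue *)

Definition mulv (n : nat) (M : nat -> nat -> R) (x : nat -> R) : nat -> R :=
  fun i => sumN n (fun j => M i j * x j).

Definition symmetric (n : nat) (M : nat -> nat -> R) : Prop :=
  forall i j, (i < n)%nat -> (j < n)%nat -> M i j = M j i.

Lemma mulv_lincomb n M a x b y :
  mulv n M (lincomb a x b y) = lincomb a (mulv n M x) b (mulv n M y).
Proof.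
  apply functional_extensionality; intros i. unfold mulv, lincomb.
  rewrite <- sumN_linear. apply sumN_ext; intros; ring.
Qed.

Lemma dot_mulv_sym n M x y :
  symmetric n M -> dot n x (mulv n M y) = dot n y (mulv n M x).
Proof.
  intros HM. unfold dot, mulv.
  rewrite (sumN_ext n _ (fun i => sumN n (fun j => x i * (M i j * y j))))
    by (intros; now rewrite sumN_scal).
  rewrite sumN_swap. apply sumN_ext; intros i Hi. rewrite <- sumN_scal.
  apply sumN_ext; intros j Hj. rewrite (HM i j) by assumption. ring.
Qed.

(** Each product [x i * x j] is at most [dot n x x] in absolute value, so the sum of the absolute
    entries works as [B]. This crude bound makes the supremum of the Rayleigh quotient exist. *)
Lemma quadratic_form_bounded n M :
  exists B, forall x, dot n x (mulv n M x) <= B * dot n x x.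
Proof.
  exists (sumN n (fun i => sumN n (fun j => Rabs (M i j)))). intros x.
  rewrite Rmult_comm, <- sumN_scal. apply sumN_le; intros i Hi.
  unfold mulv. rewrite <- !sumN_scal. apply sumN_le; intros j Hj.
  pose proof (sumN_term_le n (fun i => x i * x i) i ltac:(intros; nra) Hi) as Hxi.
  pose proof (sumN_term_le n (fun i => x i * x i) j ltac:(intros; nra) Hj) as Hxj.
  fold (dot n x x) in Hxi, Hxj; cbv beta in Hxi, Hxj.
  assert (x i * x j <= dot n x x) by nra.
  assert (- (x i * x j) <= dot n x x) by nra.
  unfold Rabs; destruct (Rcase_abs (M i j)); nra.
Qed.

(** The squared norm of [(y.y) x - (x.y) y] equals [y.y] times the difference of the two sides; the
    case [y.y = 0] is separate. *)
Lemma cauchy_schwarz_sq n x y : dot n x y * dot n x y <= dot n x x * dot n y y.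
Proof.
  pose proof (dot_self_nonneg n y) as Hy. pose proof (dot_self_nonneg n x) as Hx.
  pose proof (dot_self_nonneg n (lincomb (dot n y y) x (- dot n x y) y)) as H.
  rewrite !dot_lincomb_l, !dot_lincomb_r, (dot_sym n y x) in H.
  destruct (Req_dec (dot n y y) 0) as [E|E].
  - assert (H0 : dot n x y = 0).
    { unfold dot. rewrite (sumN_ext n _ (fun _ => 0)), sumN_const; [ring|].
      intros i Hi. rewrite (dot_self_eq0 n y E i Hi). ring. }
    rewrite H0, E. lra.
  - apply Rmult_le_reg_l with (dot n y y); nra.
Qed.

(* Induction on n: with [M n n > 0], completing the square in the last coordinate
   leaves the form of the Schur complement, which is again positive definite. *)
Lemma positive_definite_coercive n M :
  symmetric n M ->
  (forall x i, (i < n)%nat -> x i <> 0 -> 0 < dot n x (mulv n M x)) ->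
  exists c, 0 < c /\ forall x, c * dot n x x <= dot n x (mulv n M x).
Proof.
  revert M; induction n as [|n IH]; intros M HM Hpos.
  { exists 1; split; [lra|]. intros x; unfold dot; simpl; lra. }
  assert (Hsplit : forall x, dot (S n) x (mulv (S n) M x)
     = dot n x (mulv n M x) + 2 * x n * dot n (M n) x + M n n * (x n * x n)).
  { intros x. unfold dot at 1, mulv at 1; simpl.
    rewrite (sumN_ext n _ (fun i => 1 * (x i * mulv n M x i) + x n * (M n i * x i))).
    - rewrite sumN_linear. unfold dot, mulv. ring.
    - intros i Hi. rewrite (HM n i) by lia. unfold mulv. ring. }
  assert (Hd : 0 < M n n).
  { pose proof (Hpos (fun i => if Nat.eqb i n then 1 else 0) n ltac:(lia)) as H.
    simpl in H. rewrite Nat.eqb_refl in H. specialize (H ltac:(lra)).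
    rewrite Hsplit in H. simpl in H. rewrite Nat.eqb_refl in H.
    assert (E : forall y, dot n (fun i => if Nat.eqb i n then 1 else 0) y = 0).
    { intros y. unfold dot. rewrite (sumN_ext n _ (fun _ => 0)), sumN_const; [ring|].
      intros i Hi. destruct (Nat.eqb_spec i n); [lia|ring]. }
    rewrite (dot_sym n (M n)), !E in H. lra. }
  set (b := fun i => M n i / M n n).
  set (M' := fun i j => M i j - M n i * M n j / M n n).
  assert (Hschur : forall x, dot (S n) x (mulv (S n) M x)
     = dot n x (mulv n M' x) + M n n * ((x n + dot n b x) * (x n + dot n b x))).
  { intros x. rewrite Hsplit.
    assert (Eb : dot n b x = / M n n * dot n (M n) x).
    { unfold dot. rewrite <- sumN_scal. apply sumN_ext; intros; unfold b; field; lra. }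
    assert (E : dot n x (mulv n M' x)
        = dot n x (mulv n M x) + - (dot n (M n) x / M n n) * dot n (M n) x).
    { unfold dot at 1. rewrite (sumN_ext n _ (fun i => 1 * (x i * mulv n M x i)
          + - (dot n (M n) x / M n n) * (M n i * x i))).
      - rewrite sumN_linear. unfold dot. ring.
      - intros i Hi. unfold mulv.
        rewrite (sumN_ext n _ (fun j => 1 * (M i j * x j) + - (M n i / M n n) * (M n j * x j)))
          by (intros; unfold M'; field; lra).
        rewrite sumN_linear. unfold dot. field; lra. }
    rewrite E, Eb. field; lra. }
  destruct (IH M') as (c & Hc & Hcoer).
  - intros i j Hi Hj. unfold M'. rewrite (HM i j) by lia. field; lra.
  (* The last coordinate of [y] is chosen to make the completed square vanish, so the form of [M] at
     [y] is that of [M'] at [x]. *)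
  - intros x i Hi Hx. set (y := fun j => if Nat.eqb j n then - dot n b x else x j).
    assert (Hy : forall j, (j < n)%nat -> y j = x j).
    { intros j Hj. unfold y. destruct (Nat.eqb_spec j n); [lia|reflexivity]. }
    pose proof (Hpos y i ltac:(lia)) as H. rewrite Hy in H by assumption.
    specialize (H Hx). rewrite Hschur in H.
    rewrite (dot_ext n b b y x) in H by auto.
    rewrite (dot_ext n y x (mulv n M' y) (mulv n M' x)) in H; auto.
    + unfold y in H. rewrite Nat.eqb_refl in H. lra.
    + intros j Hj. apply sumN_ext; intros; rewrite Hy; auto.
  - set (G := dot n b b).
    assert (HG : 0 <= G) by apply dot_self_nonneg.
    (* With [w = x n + dot n b x], Cauchy-Schwarz gives [x n ^ 2 <= 2 w^2 + 2 G |x|^2]. The two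
       summands of [C] pay for [w^2] through [M n n * w^2] and for [(1 + 2G) |x|^2] through the
       coercivity of [M']. *)
    set (C := 2 / M n n + (1 + 2 * G) / c).
    assert (H1 : 0 < 2 / M n n) by (apply Rdiv_lt_0_compat; lra).
    assert (H2 : 0 < (1 + 2 * G) / c) by (apply Rdiv_lt_0_compat; lra).
    exists (/ C). split; [apply Rinv_0_lt_compat; unfold C; lra|]. intros x.
    apply Rmult_le_reg_l with C; [unfold C; lra|].
    rewrite <- Rmult_assoc, Rinv_r, Rmult_1_l by (unfold C; lra).
    rewrite Hschur. specialize (Hcoer x).
    pose proof (cauchy_schwarz_sq n b x) as HCS. fold G in HCS.
    pose proof (dot_self_nonneg n x) as Hx.
    change (dot (S n) x x) with (dot n x x + x n * x n).
    set (q := dot n x (mulv n M' x)) in *. set (w := x n + dot n b x).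
    assert (x n * x n <= 2 * (w * w) + 2 * (dot n b x * dot n b x)).
    { pose proof (Rle_0_sqr (w + dot n b x)). unfold Rsqr, w in *. nra. }
    assert (Hq : 0 <= q) by nra.
    assert (Hw : 0 <= M n n * (w * w)) by nra.
    assert (E1 : 2 / M n n * (M n n * (w * w)) = 2 * (w * w)) by (field; lra).
    assert (H3 : (1 + 2 * G) / c * (c * dot n x x) = (1 + 2 * G) * dot n x x) by (field; lra).
    assert (H4 : (1 + 2 * G) / c * (c * dot n x x) <= (1 + 2 * G) / c * q)
      by (apply Rmult_le_compat_l; lra).
    unfold C. nra.
Qed.

(** Evaluate near the minimum, at [-b/(c+1)] rather than [-b/c], so that [c = 0] needs no separate
    case. *)
Lemma linear_coeff_zero b c : 0 <= c -> (forall t, 0 <= 2 * t * b + t * t * c) -> b = 0.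
Proof.
  intros Hc H. specialize (H (- b / (c + 1))).
  assert (E : 2 * (- b / (c + 1)) * b + - b / (c + 1) * (- b / (c + 1)) * c
    = - (b * b) * ((c + 2) / ((c + 1) * (c + 1)))) by (field; lra).
  rewrite E in H.
  assert (0 < (c + 2) / ((c + 1) * (c + 1))) by (apply Rdiv_lt_0_compat; nra).
  apply Rsqr_0_uniq. unfold Rsqr. nra.
Qed.

(* The supremum of the Rayleigh quotient is an eigenvalue. *)
Lemma rayleigh_bound n M s :
  (0 < n)%nat -> symmetric n M ->
  (forall mu, s <= mu -> ~ is_eigenvalue n M mu) ->
  exists l, l < s /\ forall x, dot n x (mulv n M x) <= l * dot n x x.
Proof.
  intros Hn HM Hs.
  (* The reals lying below some Rayleigh quotient: the supremum is that of the quotients, and no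
     division enters. *)
  set (E := fun t => exists x, 0 < dot n x x /\ t * dot n x x <= dot n x (mulv n M x)).
  destruct (quadratic_form_bounded n M) as [B HB].
  destruct (completeness E) as [l [Hub Hlub]].
  - exists B. intros t (x & Hx & Ht). specialize (HB x).
    apply Rmult_le_reg_r with (dot n x x); lra.
  - set (x := fun _ : nat => 1).
    assert (Hx : 0 < dot n x x) by (apply (dot_self_pos n x 0); [assumption|unfold x; lra]).
    exists (dot n x (mulv n M x) / dot n x x), x. split; [assumption|].
    right; field; lra.
  - assert (Hl : forall x, dot n x (mulv n M x) <= l * dot n x x).
    { intros x. destruct (dot_self_nonneg n x) as [Hx|Hx].
      - apply Rmult_le_reg_r with (/ dot n x x); [now apply Rinv_0_lt_compat|].
        rewrite Rmult_assoc, Rinv_r, Rmult_1_r by lra. apply Hub.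
        exists x. split; [assumption|]. right; field; lra.
      - symmetry in Hx. specialize (HB x). rewrite Hx in *. lra. }
    exists l. split; [|assumption].
    destruct (Rlt_le_dec l s) as [|Hsl]; [assumption|exfalso].
    (* If [s <= l], then [l] is not an eigenvalue. The semidefinite [T = l I - M] is then definite,
       hence coercive with some [c], and [l - c] would be a smaller upper bound. *)
    set (T := fun i j => (if Nat.eqb i j then l else 0) - M i j).
    assert (ET : forall x i, (i < n)%nat -> mulv n T x i = l * x i - mulv n M x i).
    { intros x i Hi. unfold mulv.
      rewrite (sumN_ext n _ (fun j => 1 * (if Nat.eqb i j then l * x j else 0) + -1 * (M i j * x j))).
      - rewrite sumN_linear, sumN_delta by assumption. ring.
      - intros j Hj. unfold T. destruct (Nat.eqb i j); ring. }
    assert (QT : forall x, dot n x (mulv n T x) = l * dot n x x - dot n x (mulv n M x)).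
    { intros x. rewrite (dot_ext n x x _ (lincomb l x (-1) (mulv n M x))); auto.
      - rewrite dot_lincomb_r. ring.
      - intros i Hi. rewrite ET by assumption. unfold lincomb. ring. }
    assert (ST : symmetric n T).
    { intros i j Hi Hj. unfold T. rewrite (HM i j), Nat.eqb_sym by assumption. reflexivity. }
    assert (PT : forall x, 0 <= dot n x (mulv n T x)).
    { intros x. rewrite QT. specialize (Hl x). lra. }
    destruct (positive_definite_coercive n T ST) as (c & Hc & Hcoer).
    + intros x i Hi Hx. destruct (PT x) as [|H0]; [assumption|exfalso].
      symmetry in H0. apply (Hs l Hsl). exists x. split; [now exists i|].
      (* A null vector of a semidefinite form lies in the kernel: along [x + t T x] the form has no
         constant term, so its linear coefficient, twice the squared norm of [T x], vanishes. *)
      assert (Hz : dot n (mulv n T x) (mulv n T x) = 0).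
      { apply linear_coeff_zero with (dot n (mulv n T x) (mulv n T (mulv n T x))); [apply PT|].
        intros t. pose proof (PT (lincomb 1 x t (mulv n T x))) as H.
        rewrite mulv_lincomb, !dot_lincomb_l, !dot_lincomb_r, H0 in H.
        rewrite (dot_mulv_sym n T x (mulv n T x) ST) in H. lra. }
      intros j Hj. pose proof (dot_self_eq0 n _ Hz j Hj) as H.
      rewrite ET in H by assumption. unfold mulv in H. lra.
    + assert (l <= l - c); [|lra].
      apply Hlub. intros t (x & Hx & Ht). specialize (Hcoer x). rewrite QT in Hcoer.
      apply Rmult_le_reg_r with (dot n x x); lra.
Qed.

(** * Graph Laplacians: Dirichlet form, kernel, spectral gap, perturbation *)

Lemma mulv_laplacian n A x i :
  valid_adj n A -> (i < n)%nat ->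
  mulv n (laplacian n A) x i = sumN n (fun j => A i j * (x i - x j)).
Proof.
  intros HA Hi. unfold mulv.
  set (d := sumN n (A i)).
  assert (Hd : sumN n (fun l => if Nat.eqb l i then 0 else A i l) = d).
  { apply sumN_ext; intros l Hl. destruct (Nat.eqb_spec l i) as [->|]; [|reflexivity].
    symmetry; apply (HA i i); assumption. }
  rewrite (sumN_ext n _ (fun j => 1 * (if Nat.eqb i j then d * x j else 0) + -1 * (A i j * x j))).
  - rewrite sumN_linear, sumN_delta by assumption.
    rewrite (sumN_ext n (fun j => A i j * (x i - x j)) (fun j => x i * A i j + -1 * (A i j * x j)))
      by (intros; ring).
    rewrite sumN_linear. unfold d. ring.
  - intros j Hj. unfold laplacian. rewrite Hd.
    destruct (Nat.eqb_spec i j) as [<-|]; [|ring].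
    destruct (HA i i Hi Hi) as (_ & _ & ->). ring.
Qed.

Lemma laplacian_symmetric n A : valid_adj n A -> symmetric n (laplacian n A).
Proof.
  intros HA i j Hi Hj. unfold laplacian. rewrite (Nat.eqb_sym j i).
  destruct (Nat.eqb_spec i j) as [->|]; [reflexivity|].
  destruct (HA i j Hi Hj) as [-> _]. reflexivity.
Qed.

(** Symmetry of [A] lets [i] and [j] be exchanged in the double sum; adding both versions turns
    [x i (x i - x j)] into [(x i - x j)^2]. *)
Lemma dirichlet_form n A x :
  valid_adj n A ->
  2 * dot n x (mulv n (laplacian n A) x)
    = sumN n (fun i => sumN n (fun j => A i j * ((x i - x j) * (x i - x j)))).
Proof.
  intros HA.
  assert (E : dot n x (mulv n (laplacian n A) x)
     = sumN n (fun i => sumN n (fun j => A i j * (x i * (x i - x j))))).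
  { apply sumN_ext; intros i Hi. rewrite mulv_laplacian, <- sumN_scal by assumption.
    apply sumN_ext; intros; ring. }
  assert (E' : dot n x (mulv n (laplacian n A) x)
     = sumN n (fun i => sumN n (fun j => A i j * (x j * (x j - x i))))).
  { rewrite E, sumN_swap. apply sumN_ext; intros i Hi; apply sumN_ext; intros j Hj.
    destruct (HA i j Hi Hj) as [-> _]. reflexivity. }
  replace (2 * dot n x (mulv n (laplacian n A) x)) with
    (dot n x (mulv n (laplacian n A) x) + dot n x (mulv n (laplacian n A) x)) by ring.
  rewrite E at 1. rewrite E', <- sumN_plus.
  apply sumN_ext; intros i Hi. rewrite <- sumN_plus. apply sumN_ext; intros; ring.
Qed.

Lemma laplacian_psd n A x : valid_adj n A -> 0 <= dot n x (mulv n (laplacian n A) x).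
Proof.
  intros HA. apply Rmult_le_reg_l with 2; [lra|]. rewrite dirichlet_form, Rmult_0_r by assumption.
  apply sumN_nonneg; intros i Hi; apply sumN_nonneg; intros j Hj.
  destruct (HA i j Hi Hj) as (_ & H & _). apply Rmult_le_pos; [assumption|apply Rle_0_sqr].
Qed.

(** By symmetry this is the pairing of [x] with the Laplacian of a constant vector, which is zero.
    It makes the control preserve the mean velocity. *)
Lemma sumN_mulv_laplacian n A x : valid_adj n A -> sumN n (mulv n (laplacian n A) x) = 0.
Proof.
  intros HA. transitivity (dot n (fun _ => 1) (mulv n (laplacian n A) x)).
  { apply sumN_ext; intros; ring. }
  rewrite dot_mulv_sym by now apply laplacian_symmetric.
  unfold dot. rewrite (sumN_ext n _ (fun _ => 0)), sumN_const; [ring|].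
  intros i Hi. rewrite mulv_laplacian by assumption.
  rewrite (sumN_ext n _ (fun _ => 0)), sumN_const by (intros; ring). ring.
Qed.

(** All terms of the Dirichlet form are nonnegative, so each vanishes; [x] agrees across every edge,
    hence along every path. *)
Lemma laplacian_kernel n A x :
  valid_adj n A -> graph_connected n A -> dot n x (mulv n (laplacian n A) x) = 0 ->
  forall i j, (i < n)%nat -> (j < n)%nat -> x i = x j.
Proof.
  intros HA Hconn H0 i j Hi Hj. specialize (Hconn i j Hi Hj).
  induction Hconn as [i j (_ & _ & Ha)| |i k j H1 IH1 H2 IH2]; [|reflexivity|].
  - set (f := fun i j => A i j * ((x i - x j) * (x i - x j))).
    assert (Hf : forall i j, (i < n)%nat -> (j < n)%nat -> 0 <= f i j).
    { intros k l Hk Hl. unfold f. destruct (HA k l Hk Hl) as (_ & H & _). apply Rmult_le_pos; [assumption|apply Rle_0_sqr]. }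
    assert (Hle : f i j <= 0).
    2: { apply Rminus_diag_uniq, Rsqr_0_uniq. apply Rle_antisym; [|apply Rle_0_sqr].
         apply Rmult_le_reg_l with (A i j); [assumption|]. unfold f in Hle. unfold Rsqr. lra. }
    pose proof (dirichlet_form n A x HA) as E. rewrite H0, Rmult_0_r in E. rewrite E.
    apply Rle_trans with (sumN n (f i)).
    + apply sumN_term_le; auto.
    + apply (sumN_term_le n (fun i => sumN n (f i))); [|assumption].
      intros k Hk. apply sumN_nonneg; auto.
  (* The closure ranges over all of [nat], so the bound on the intermediate vertex has to be
     recovered from the path leading to it. *)
  - assert (Hk : (k < n)%nat).
    { clear IH1 IH2 H2. induction H1 as [? ? (_ & ? & _)| |]; auto. }
    now rewrite IH1, IH2.
Qed.

(* [L + J], with [J] the all-ones matrix, is positive definite and agrees with [L]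
   on mean-free vectors. *)
Lemma laplacian_poincare n A :
  valid_adj n A -> graph_connected n A ->
  exists P, 0 < P /\ forall x, sumN n x = 0 ->
    dot n x x <= P * dot n x (mulv n (laplacian n A) x).
Proof.
  intros HA Hconn.
  set (T := fun i j => laplacian n A i j + 1).
  assert (QT : forall x, dot n x (mulv n T x)
     = dot n x (mulv n (laplacian n A) x) + sumN n x * sumN n x).
  { intros x. rewrite <- sumN_scal. unfold dot. rewrite <- sumN_plus.
    apply sumN_ext; intros i Hi. unfold mulv, T.
    rewrite (sumN_ext n _ (fun j => laplacian n A i j * x j + x j)) by (intros; ring).
    rewrite sumN_plus. ring. }
  destruct (positive_definite_coercive n T) as (c & Hc & Hcoer).
  - intros i j Hi Hj. unfold T. rewrite (laplacian_symmetric n A HA i j) by assumption. reflexivity.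
  - intros x i Hi Hx. rewrite QT. pose proof (laplacian_psd n A x HA) as Hpsd.
    destruct Hpsd as [Hp|Hz]; [nra|]. symmetry in Hz.
    pose proof (laplacian_kernel n A x HA Hconn Hz) as Hker.
    rewrite Hz, (sumN_ext n x (fun _ => x i)), sumN_const by auto.
    assert (0 < INR n) by (apply lt_0_INR; lia).
    assert (INR n * x i <> 0) by (apply Rmult_integral_contrapositive; lra). nra.
  - exists (/ c). split; [now apply Rinv_0_lt_compat|]. intros x Hx.
    specialize (Hcoer x). rewrite QT, Hx in Hcoer.
    apply Rmult_le_reg_l with c; [assumption|].
    rewrite <- Rmult_assoc, Rinv_r by lra. lra.
Qed.

(** Semidefiniteness at the single vector [B x - M x], with the upper bound applied at [M x],
    replaces a spectral decomposition. *)
Lemma mulv_sq_le n M B x :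
  symmetric n M -> 0 < B ->
  (forall y, 0 <= dot n y (mulv n M y)) ->
  (forall y, dot n y (mulv n M y) <= B * dot n y y) ->
  dot n (mulv n M x) (mulv n M x) <= B * dot n x (mulv n M x).
Proof.
  intros HM HB Hpsd Hle. set (y := mulv n M x).
  pose proof (Hpsd (lincomb B x (-1) y)) as H. specialize (Hle y).
  rewrite mulv_lincomb, !dot_lincomb_l, !dot_lincomb_r, (dot_mulv_sym n M x y HM) in H.
  fold y in H. set (q := dot n y (mulv n M y)) in *. set (r := dot n x y) in *.
  apply Rmult_le_reg_l with B; [assumption|]. lra.
Qed.

(** Cauchy-Schwarz in each row separates the entries of [A - B], contributing at most [n d^2], from
    the differences [y i - y j], whose squares are at most [2 (y i)^2 + 2 (y j)^2]. *)
Lemma laplacian_perturbation n A B d y :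
  valid_adj n A -> valid_adj n B ->
  (forall i j, (i < n)%nat -> (j < n)%nat -> Rabs (B i j - A i j) < d) ->
  let e := lincomb 1 (mulv n (laplacian n A) y) (-1) (mulv n (laplacian n B) y) in
  dot n e e <= 4 * (INR n * INR n) * (d * d) * dot n y y.
Proof.
  intros HA HB Hd e. pose proof (pos_INR n) as Hn.
  apply Rle_trans with
    (sumN n (fun i => INR n * (d * d) * (2 * INR n * (y i * y i) + 2 * dot n y y))).
  - apply sumN_le; intros i Hi. unfold e, lincomb. rewrite !mulv_laplacian by assumption.
    rewrite <- sumN_linear.
    set (D := fun j => A i j - B i j). set (z := fun j => y i - y j).
    rewrite (sumN_ext n _ (fun j => D j * z j)) by (intros; unfold D, z; ring).
    fold (dot n D z). apply Rle_trans with (1 := cauchy_schwarz_sq n D z).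
    apply Rmult_le_compat; try apply dot_self_nonneg.
    + unfold dot. rewrite <- sumN_const. apply sumN_le; intros j Hj.
      specialize (Hd i j Hi Hj). apply Rabs_def2 in Hd. unfold D. nra.
    + unfold dot. replace (2 * INR n * (y i * y i)) with (INR n * (2 * (y i * y i))) by ring.
      rewrite <- sumN_const, <- sumN_scal, <- sumN_plus.
      apply sumN_le; intros j Hj. unfold z. pose proof (Rle_0_sqr (y i + y j)).
      unfold Rsqr in *. nra.
  - right. rewrite sumN_scal, sumN_plus, sumN_scal, sumN_const. unfold dot. ring.
Qed.

Lemma control_laplacian n g1 g2 A p v i :
  valid_adj n A -> (i < n)%nat ->
  control n g1 g2 A p v i
    = - (g1 * mulv n (laplacian n A) p i + g2 * mulv n (laplacian n A) v i).
Proof.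
  intros HA Hi. unfold control. rewrite !mulv_laplacian by assumption.
  replace (- (g1 * sumN n (fun j => A i j * (p i - p j)) + g2 * sumN n (fun j => A i j * (v i - v j))))
   with (g1 * (-1 * sumN n (fun j => A i j * (p i - p j)))
         + g2 * (-1 * sumN n (fun j => A i j * (v i - v j)))) by ring.
  rewrite <- !sumN_scal. f_equal; apply sumN_ext; intros; ring.
Qed.

(** * The energy and its exact change in one step *)

(** With [K = I - (h/2) M] this is [<v,Kv> + a <m,Mm> + eps <m,Kv>], written out so that only [M]
    occurs. *)
Definition energy (n : nat) (M : nat -> nat -> R) (a h eps : R) (m v : nat -> R) : R :=
  dot n v v - h / 2 * dot n v (mulv n M v) + a * dot n m (mulv n M m)
  + eps * (dot n m v - h / 2 * dot n m (mulv n M v)).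

Lemma energy_ext n M a h eps m m' v v' :
  (forall i, (i < n)%nat -> m i = m' i) -> (forall i, (i < n)%nat -> v i = v' i) ->
  energy n M a h eps m v = energy n M a h eps m' v'.
Proof.
  intros Hm Hv.
  assert (HM : forall x y, (forall i, (i < n)%nat -> x i = y i) -> mulv n M x = mulv n M y).
  { intros x y H. apply functional_extensionality; intros i.
    apply sumN_ext; intros j Hj. now rewrite H. }
  unfold energy. rewrite (HM m m' Hm), (HM v v' Hv).
  rewrite (dot_ext n v v' v v'), (dot_ext n v v' (mulv n M v') (mulv n M v')),
    (dot_ext n m m' (mulv n M m') (mulv n M m')), (dot_ext n m m' v v'),
    (dot_ext n m m' (mulv n M v') (mulv n M v')); auto.
Qed.

(* [e] is the deviation of [s] from the unperturbed value [2 K v - a M m] of [v + v']. *)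
Lemma energy_step n M a h eps m v s :
  symmetric n M ->
  let e := lincomb 1 (lincomb 1 s (-2) v) 1 (lincomb h (mulv n M v) a (mulv n M m)) in
  energy n M a h eps (lincomb 1 m (1 / 2) s) (lincomb 1 s (-1) v)
  = energy n M a h eps m v
    + (1 + eps / 4) * dot n s e + eps * dot n m e
    - (h / 2 - a / 4) * dot n s (mulv n M s)
    + eps * (- a * dot n m (mulv n M m) - (h / 2 + a / 4) * dot n m (mulv n M s)
             + 1 / 4 * dot n s s - h / 4 * dot n s (mulv n M s)).
Proof.
  intros HM e. unfold energy, e. rewrite !mulv_lincomb.
  rewrite !dot_lincomb_l, !dot_lincomb_r.
  rewrite (dot_mulv_sym n M s m HM), (dot_mulv_sym n M s v HM).
  rewrite (dot_sym n v s).
  field.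
Qed.

(** * Strict decrease of the energy under small perturbations *)

Section Dissipation.

(** In the application [M] is the Laplacian at time 0, [a = g1] and [h = g2 - g1/2]. Then [h_gt]
    amounts to [g1 < g2], and [coercive] says that [K] is at least [k] times the identity. *)
Variables (n : nat) (M : nat -> nat -> R) (a h k P : R).
Hypothesis M_sym : symmetric n M.
Hypothesis M_psd : forall x, 0 <= dot n x (mulv n M x).
Hypothesis a_pos : 0 < a.
Hypothesis h_gt : a / 2 < h.
Hypothesis k_pos : 0 < k.
Hypothesis coercive : forall x, k * dot n x x <= dot n x x - h / 2 * dot n x (mulv n M x).
Hypothesis P_pos : 0 < P.
Hypothesis poincare : forall x, sumN n x = 0 -> dot n x x <= P * dot n x (mulv n M x).

Local Notation sq x := (dot n x x).
Local Notation D x := (dot n x (mulv n M x)).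

(** Positivity of [K] at [m + v] bounds the cross term below by minus half of [|m|^2 + <v,Kv>]. The
    factor [eps] is small enough for [<v,Kv>] and, through Poincare, [a <m,Mm>] to absorb this. *)
Lemma energy_nonneg eps m v :
  0 < eps -> eps <= 1 -> eps <= 2 * a / P -> sumN n m = 0 ->
  0 <= energy n M a h eps m v.
Proof.
  intros H0 H1 HP Hm. unfold energy.
  pose proof (coercive (lincomb 1 m 1 v)) as H.
  rewrite mulv_lincomb, !dot_lincomb_l, !dot_lincomb_r in H.
  rewrite (dot_mulv_sym n M v m M_sym), (dot_sym n v m) in H.
  pose proof (dot_self_nonneg n (lincomb 1 m 1 v)) as Hn.
  rewrite !dot_lincomb_l, !dot_lincomb_r, (dot_sym n v m) in Hn.
  pose proof (coercive v). pose proof (poincare m Hm). pose proof (M_psd m).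
  pose proof (dot_self_nonneg n v). pose proof (dot_self_nonneg n m).
  assert (Hk : 0 <= k * (sq m + 2 * dot n m v + sq v)) by (apply Rmult_le_pos; lra).
  assert (Hv : 0 <= sq v - h / 2 * D v) by nra.
  assert (Hh : 0 <= h / 2 * D m) by (apply Rmult_le_pos; lra).
  set (W := dot n m v - h / 2 * dot n m (mulv n M v)).
  assert (HW : - (sq m + (sq v - h / 2 * D v)) <= 2 * W) by (unfold W; lra).
  assert (HePm : eps * sq m <= 2 * a * D m).
  { apply Rle_trans with (2 * a / P * (P * D m)); [|right; field; lra].
    apply Rmult_le_compat; lra. }
  nra.
Qed.

(** The decrease of the energy is visible in [s] and [m] only; this recovers [v]. Pairing the
    definition of [e] with [v] gives [2 <v,Kv> = <v,s> - <v,e> + a <v,Mm>]; three Young inequalities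
    of weight [k/6] use up half of [k |v|^2]. *)
Lemma velocity_bound m v s :
  let e := lincomb 1 (lincomb 1 s (-2) v) 1 (lincomb h (mulv n M v) a (mulv n M m)) in
  sq v <= 3 / (4 * (k * k)) * (sq s + sq e + a * a * (2 / h * D m)).
Proof.
  intros e.
  assert (E : dot n v e = dot n v s - 2 * sq v + h * D v + a * dot n v (mulv n M m)).
  { unfold e. rewrite !dot_lincomb_r. ring. }
  assert (Hw : 0 < k / 6) by lra.
  pose proof (young n (1 / 2) (k / 6) v s Hw) as Y1.
  pose proof (young n (- (1 / 2)) (k / 6) v e Hw) as Y2.
  pose proof (young n (a / 2) (k / 6) v (mulv n M m) Hw) as Y3.
  pose proof (coercive v) as Hc.
  (* Coercivity of [K] also says that [M] is at most [2/h] times the identity. *)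
  assert (HB : sq (mulv n M m) <= 2 / h * D m).
  { apply mulv_sq_le; auto; [apply Rdiv_lt_0_compat; lra|].
    intros y. apply Rmult_le_reg_l with (h / 2); [lra|].
    pose proof (coercive y). pose proof (dot_self_nonneg n y).
    replace (h / 2 * (2 / h * sq y)) with (sq y) by (field; lra). nra. }
  assert (HB' : a * a * sq (mulv n M m) <= a * a * (2 / h * D m))
    by (apply Rmult_le_compat_l; nra).
  set (LL := sq (mulv n M m)) in *. set (BD := 2 / h * D m) in *.
  apply Rmult_le_reg_l with (k / 2); [lra|].
  replace (k / 2 * (3 / (4 * (k * k)) * (sq s + sq e + a * a * BD)))
    with (3 / (8 * k) * (sq s + sq e + a * a * BD)) by (field; lra).
  apply Rle_trans with (3 / (8 * k) * (sq s + sq e + a * a * LL)).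
  - replace (1 / 2 * (1 / 2) / (4 * (k / 6)) * sq s) with (3 / (8 * k) * sq s) in Y1
      by (field; lra).
    replace (- (1 / 2) * - (1 / 2) / (4 * (k / 6)) * sq e) with (3 / (8 * k) * sq e) in Y2
      by (field; lra).
    replace (a / 2 * (a / 2) / (4 * (k / 6)) * LL) with (3 / (8 * k) * (a * a * LL)) in Y3
      by (field; lra).
    lra.
  - apply Rmult_le_compat_l; [|lra]. left; apply Rdiv_lt_0_compat; lra.
Qed.

(** In [energy_step] the good terms are [-c2 <s,Ms>] and [-eps a <m,Mm>]. The other terms of the
    [eps] bracket cost half of each at most, and the error terms half of the remaining [eta0 q],
    where [q = <s,Ms> + <m,Mm>]. The constants do not depend on [m], [v], [s]. *)
Lemma energy_dissipation :
  exists eps tau eta, 0 < tau /\ 0 < eta /\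
    (forall m v, sumN n m = 0 -> 0 <= energy n M a h eps m v) /\
    forall m v s, sumN n m = 0 -> sumN n s = 0 ->
      let e := lincomb 1 (lincomb 1 s (-2) v) 1 (lincomb h (mulv n M v) a (mulv n M m)) in
      sq e <= tau * (sq m + sq v) ->
      energy n M a h eps (lincomb 1 m (1 / 2) s) (lincomb 1 s (-1) v)
        <= energy n M a h eps m v - eta * (sq m + sq v).
Proof.
  set (b := h / 2 + a / 4). set (c2 := h / 2 - a / 4).
  set (C1 := b * b / (2 * a) + P / 4).
  assert (Hc2 : 0 < c2) by (unfold c2; lra).
  assert (HC1 : 0 < C1).
  { unfold C1. assert (0 < b * b / (2 * a)) by (apply Rdiv_lt_0_compat; unfold b; nra). lra. }
  assert (HaP : 0 < 2 * a / P) by (apply Rdiv_lt_0_compat; lra).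
  assert (HcC : 0 < c2 / (2 * C1)) by (apply Rdiv_lt_0_compat; lra).
  (* The first two caps are those of [energy_nonneg]; the third keeps [eps * C1] below half of
     [c2]. *)
  set (eps := Rmin 1 (Rmin (2 * a / P) (c2 / (2 * C1)))).
  assert (He0 : 0 < eps) by (unfold eps; repeat apply Rmin_glb_lt; lra).
  assert (He1 : eps <= 1) by apply Rmin_l.
  assert (He2 : eps <= 2 * a / P)
    by (eapply Rle_trans; [apply Rmin_r|apply Rmin_l]).
  assert (He3 : eps * C1 <= c2 / 2).
  { replace (c2 / 2) with (c2 / (2 * C1) * C1) by (field; lra).
    apply Rmult_le_compat_r; [lra|]. eapply Rle_trans; [apply Rmin_r|apply Rmin_r]. }
  set (eta0 := Rmin (c2 / 2) (eps * a / 2)).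
  assert (Hea : 0 < eps * a) by (apply Rmult_lt_0_compat; lra).
  assert (Heta0 : 0 < eta0) by (apply Rmin_glb_lt; lra).
  assert (Heta1 : eta0 <= c2 / 2) by apply Rmin_l.
  assert (Heta2 : eta0 <= eps * a / 2) by apply Rmin_r.
  (* Young weight for the error terms: by Poincare, [w (|s|^2 + |m|^2)] is at most a quarter of
     [eta0 q]. *)
  set (w := eta0 / (4 * P)).
  assert (Hw : 0 < w) by (apply Rdiv_lt_0_compat; lra).
  set (C2 := 3 / (4 * (k * k))).
  assert (HC2 : 0 < C2) by (apply Rdiv_lt_0_compat; nra).
  set (B := a * a * (2 / h)).
  assert (HB : 0 < B).
  { unfold B. apply Rmult_lt_0_compat; [nra|]. apply Rdiv_lt_0_compat; lra. }
  set (C3 := P + C2 * P + C2 * B).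
  assert (HC2P : 0 < C2 * P) by (apply Rmult_lt_0_compat; lra).
  assert (HC2B : 0 < C2 * B) by (apply Rmult_lt_0_compat; lra).
  assert (HC3 : 0 < C3) by (unfold C3; lra).
  assert (Ht1 : 0 < 1 / (2 * C2)) by (apply Rdiv_lt_0_compat; lra).
  assert (Ht2 : 0 < eta0 * w / (16 * C3)) by (apply Rdiv_lt_0_compat; nra).
  (* The first cap allows [C2 |e|^2] to be absorbed as half of [z]; the second makes [|e|^2 / w] at
     most [eta0 q / 8], and this occurs twice. *)
  set (tau := Rmin (1 / (2 * C2)) (eta0 * w / (16 * C3))).
  exists eps, tau, (eta0 / (4 * C3)).
  split; [now apply Rmin_glb_lt|]. split; [apply Rdiv_lt_0_compat; lra|].
  split; [intros; now apply energy_nonneg|].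
  intros m v s Hm Hs e He.
  pose proof (energy_step n M a h eps m v s M_sym) as Hstep. cbv zeta in Hstep.
  fold e b c2 in Hstep. rewrite Hstep; clear Hstep.
  pose proof (velocity_bound m v s) as Hv. cbv zeta in Hv. fold e C2 in Hv.
  replace (a * a * (2 / h * D m)) with (B * D m) in Hv by (unfold B; ring).
  pose proof (poincare m Hm) as Pm. pose proof (poincare s Hs) as Ps.
  pose proof (M_psd m) as Dm0. pose proof (M_psd s) as Ds0.
  pose proof (dot_self_nonneg n e) as ee0.
  pose proof (dot_self_nonneg n v) as vv0.
  pose proof (dot_self_nonneg n m) as mm0.
  pose proof (young n (1 + eps / 4) w s e Hw) as Yse.
  pose proof (young n eps w m e Hw) as Yme.
  (* Young inequality for the seminorm of [M], from semidefiniteness at [a m + b s]. *)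
  assert (Hms : - b * dot n m (mulv n M s) <= a / 2 * D m + b * b / (2 * a) * D s).
  { pose proof (M_psd (lincomb a m b s)) as H.
    rewrite mulv_lincomb, !dot_lincomb_l, !dot_lincomb_r, (dot_mulv_sym n M s m M_sym) in H.
    apply Rmult_le_reg_l with (2 * a); [lra|].
    replace (2 * a * (a / 2 * D m + b * b / (2 * a) * D s)) with (a * a * D m + b * b * D s)
      by (field; lra). lra. }
  set (z := sq m + sq v) in *. set (q := D s + D m).
  set (ee := sq e) in *. set (Ds := D s) in *. set (Dm := D m) in *.
  set (ss := sq s) in *. set (mm := sq m) in *. set (vv := sq v) in *.
  set (mLs := dot n m (mulv n M s)) in *. set (se := dot n s e) in *. set (me := dot n m e) in *.
  set (U := energy n M a h eps m v).
  clearbody U ee Ds Dm ss mm vv mLs se me; clear e Hm Hs m v s.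
  assert (Hz0 : 0 <= z) by (unfold z; lra).
  (* Poincare and [velocity_bound] give [z <= C3 q + C2 |e|^2], and the last term is at most
     [z/2]. *)
  assert (Hz : z <= 2 * C3 * q).
  { assert (C2 * ee <= 1 / 2 * z).
    { apply Rle_trans with (C2 * (1 / (2 * C2) * z)); [|right; field; lra].
      apply Rmult_le_compat_l; [lra|]. apply Rle_trans with (1 := He).
      apply Rmult_le_compat_r; [assumption|apply Rmin_l]. }
    assert (C2 * ss <= C2 * (P * Ds)) by (apply Rmult_le_compat_l; lra).
    assert (0 <= P * Ds) by (apply Rmult_le_pos; lra).
    assert (0 <= C2 * P * Dm) by (apply Rmult_le_pos; lra).
    assert (0 <= C2 * B * Ds) by (apply Rmult_le_pos; lra).
    unfold z, C3, q in *. lra. }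
  assert (Hee : ee / w <= eta0 / 8 * q).
  { apply Rmult_le_reg_r with w; [assumption|].
    replace (ee / w * w) with ee by (field; lra). apply Rle_trans with (1 := He).
    apply Rle_trans with (eta0 * w / (16 * C3) * (2 * C3 * q)); [|right; field; lra].
    apply Rmult_le_compat; [left; now apply Rmin_glb_lt|assumption|apply Rmin_r|assumption]. }
  assert (Hwss : w * (ss + mm) <= eta0 / 4 * q).
  { apply Rle_trans with (w * (P * q)); [|right; unfold w; field; lra].
    apply Rmult_le_compat_l; [lra|unfold q; lra]. }
  assert (Hw4 : forall t, 0 <= t -> t <= 2 -> t * t / (4 * w) * ee <= ee / w).
  { intros t Ht0 Ht. replace (ee / w) with (4 / (4 * w) * ee) by (field; lra).
    apply Rmult_le_compat_r; [assumption|]. apply Rmult_le_compat_r; [|nra].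
    left; apply Rinv_0_lt_compat; lra. }
  pose proof (Hw4 (1 + eps / 4) ltac:(lra) ltac:(lra)).
  pose proof (Hw4 eps ltac:(lra) ltac:(lra)).
  assert (Hcross : - a * Dm - b * mLs + 1 / 4 * ss - h / 4 * Ds <= - (a / 2) * Dm + C1 * Ds).
  { assert (0 <= h / 4 * Ds) by (apply Rmult_le_pos; lra). unfold C1. lra. }
  apply Rmult_le_compat_l with (r := eps) in Hcross; [|lra].
  assert (eps * C1 * Ds <= c2 / 2 * Ds) by (apply Rmult_le_compat_r; lra).
  assert (eta0 * Ds <= c2 / 2 * Ds) by (apply Rmult_le_compat_r; lra).
  assert (eta0 * Dm <= eps * a / 2 * Dm) by (apply Rmult_le_compat_r; lra).
  assert (eta0 / (4 * C3) * z <= eta0 / 2 * q).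
  { apply Rle_trans with (eta0 / (4 * C3) * (2 * C3 * q)); [|right; field; lra].
    apply Rmult_le_compat_l; [left; apply Rdiv_lt_0_compat; lra|assumption]. }
  unfold q in *. lra.
Qed.

End Dissipation.

(** * Convergence of sequences from dissipation *)

(** [U] decreases and is bounded below, so it converges; [eta * z k] is at most the difference of
    consecutive values of [U], which tends to zero. *)
Lemma dissipated_cv_0 (U z : nat -> R) eta :
  0 < eta -> (forall k, 0 <= U k) -> (forall k, 0 <= z k) ->
  (forall k, U (S k) <= U k - eta * z k) -> Un_cv z 0.
Proof.
  intros Heta HU Hz Hdec.
  destruct (decreasing_cv U) as [l Hl].
  - intros k. specialize (Hdec k). specialize (Hz k). nra.
  - exists 0. intros x (k & ->). unfold opp_seq. specialize (HU k). lra.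
  - intros eps Heps. destruct (Hl (eta * eps / 2)) as [K HK]; [nra|].
    exists K. intros k Hk. pose proof (HK k Hk) as H1. pose proof (HK (S k) ltac:(lia)) as H2.
    unfold Rdist in *. apply Rabs_def2 in H1, H2.
    rewrite Rminus_0_r, Rabs_pos_eq by apply Hz.
    specialize (Hdec k). apply Rmult_lt_reg_l with eta; [assumption|]. lra.
Qed.

Lemma cv_0_of_sq_le x z C :
  0 < C -> Un_cv z 0 -> (forall k, x k * x k <= C * z k) -> Un_cv x 0.
Proof.
  intros HC Hz Hx eps Heps.
  destruct (Hz (eps * eps / C)) as [K HK]; [apply Rdiv_lt_0_compat; nra|].
  exists K. intros k Hk. specialize (HK k Hk). specialize (Hx k).
  unfold Rdist in *. rewrite Rminus_0_r in *. apply Rabs_def2 in HK.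
  assert (C * z k < eps * eps).
  { replace (eps * eps) with (C * (eps * eps / C)) by (field; lra).
    apply Rmult_lt_compat_l; lra. }
  apply Rabs_def1; nra.
Qed.

(** * Removal of the averages from the dynamics *)

Definition center (n : nat) (x : nat -> R) : nat -> R := fun i => x i - sumN n x / INR n.

Lemma sumN_center n x : (0 < n)%nat -> sumN n (center n x) = 0.
Proof.
  intros Hn. assert (0 < INR n) by now apply lt_0_INR. unfold center.
  rewrite (sumN_ext n _ (fun i => x i + - (sumN n x / INR n))) by (intros; ring).
  rewrite sumN_plus, sumN_const. field; lra.
Qed.

Lemma mulv_laplacian_center n A x i :
  valid_adj n A -> (i < n)%nat ->
  mulv n (laplacian n A) (center n x) i = mulv n (laplacian n A) x i.
Proof.
  intros HA Hi. rewrite !mulv_laplacian by assumption.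
  apply sumN_ext; intros; unfold center; ring.
Qed.

Lemma sumN_lincomb n a x b y : sumN n (lincomb a x b y) = a * sumN n x + b * sumN n y.
Proof. apply sumN_linear. Qed.

(** The control has zero sum, so the mean velocity is constant and the mean position advances by it;
    the Laplacian does not see constants and may act on the centered vectors. *)
Lemma centered_step n g1 g2 A p v p' v' :
  valid_adj n A ->
  (forall i, (i < n)%nat -> p' i = p i + v i /\ v' i = v i + control n g1 g2 A p v i) ->
  forall i, (i < n)%nat ->
    center n p' i = center n p i + center n v i /\
    center n v' i = center n v i
      - (g1 * mulv n (laplacian n A) (center n p) i + g2 * mulv n (laplacian n A) (center n v) i).
Proof.
  intros HA Hstep i Hi. rewrite !mulv_laplacian_center by assumption.
  destruct (Hstep i Hi) as [Hp Hv]. rewrite control_laplacian in Hv by assumption.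
  assert (0 < INR n) by (apply lt_0_INR; lia). unfold center. rewrite Hp, Hv. split.
  - rewrite (sumN_ext n p' (fun j => p j + v j)) by (intros j Hj; apply (Hstep j Hj)).
    rewrite sumN_plus. field; lra.
  - rewrite (sumN_ext n v' (fun j => v j + -1 * lincomb g1 (mulv n (laplacian n A) p)
                                               g2 (mulv n (laplacian n A) v) j)).
    + rewrite sumN_plus, sumN_scal, sumN_lincomb, !sumN_mulv_laplacian by assumption.
      field; lra.
    + intros j Hj. destruct (Hstep j Hj) as [_ Hvj].
      rewrite Hvj, control_laplacian by assumption. unfold lincomb. ring.
Qed.

(** * Choice of the perturbation radius and consensus *)

Theorem theorem1 :
  forall (N : nat) (g1 g2 : R) (A0 : nat -> nat -> R),
    (2 <= N)%nat ->
    valid_adj N A0 ->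
    graph_connected N A0 ->
    0 < g1 -> g1 < g2 ->
    (forall mu, mu <> 0 -> is_eigenvalue N (laplacian N A0) mu ->
       g1 - 2 * g2 > - (4 / mu)) ->
    exists deltaA : R, deltaA > 0 /\
      forall (A : nat -> nat -> nat -> R) (p v : nat -> nat -> R),
        (forall i j, (i < N)%nat -> (j < N)%nat -> A 0%nat i j = A0 i j) ->
        (forall k, valid_adj N (A k)) ->
        (forall k i j, (i < N)%nat -> (j < N)%nat ->
           Rabs (A k i j - A0 i j) < deltaA) ->
        (forall k i, (i < N)%nat ->
           p (S k) i = p k i + v k i /\
           v (S k) i = v k i + control N g1 g2 (A k) (p k) (v k) i) ->
        forall i j, (i < N)%nat -> (j < N)%nat ->
          Un_cv (fun k => p k i - p k j) 0 /\
          Un_cv (fun k => v k i - v k j) 0.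
Proof.
  intros N g1 g2 A0 HN HA0 Hconn Hg1 Hg2 Heig.
  set (L := laplacian N A0). set (h := g2 - g1 / 2).
  assert (Hh : g1 / 2 < h) by (unfold h; lra).
  assert (HL : symmetric N L) by now apply laplacian_symmetric.
  destruct (rayleigh_bound N L (2 / h)) as (l & Hl & HlL); [lia|assumption| |].
  (* Since [2 h = 2 g2 - g1], the hypothesis reads [2 h < 4 / mu], which fails for every
     [mu >= 2 / h]. *)
  { intros mu Hmu Hev.
    assert (Hmu0 : 0 < mu) by (apply Rlt_le_trans with (2 / h); [apply Rdiv_lt_0_compat; lra|lra]).
    specialize (Heig mu ltac:(lra) Hev).
    apply Rmult_le_compat_l with (r := h) in Hmu; [|lra].
    replace (h * (2 / h)) with 2 in Hmu by (field; lra).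
    assert (Hlt : 2 * h < 4 / mu) by (unfold h; lra).
    apply Rmult_lt_compat_r with (r := mu) in Hlt; [|assumption].
    replace (4 / mu * mu) with 4 in Hlt by (field; lra). lra. }
  destruct (laplacian_poincare N A0 HA0 Hconn) as (P & HP & Hpoinc).
  assert (Hk : 0 < 1 - h / 2 * l).
  { assert (h / 2 * l < h / 2 * (2 / h)) by (apply Rmult_lt_compat_l; lra).
    replace (h / 2 * (2 / h)) with 1 in H by (field; lra). lra. }
  destruct (energy_dissipation N L g1 h (1 - h / 2 * l) P)
    as (eps & tau & eta & Htau & Heta & Hpos & Hdiss); auto.
  { intros x. now apply laplacian_psd. }
  { intros x. specialize (HlL x). apply Rmult_le_compat_l with (r := h / 2) in HlL; lra. }
  assert (HN0 : 0 < INR N) by (apply lt_0_INR; lia).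
  (* The error obeys [|e|^2 <= G d^2 z]: a factor [4 N^2 d^2] from [laplacian_perturbation] and
     [2 (g1^2 + h^2)] from [|g1 m + h v|^2]. As [d <= 1], [d <= tau / G] suffices. *)
  set (G := 8 * (INR N * INR N) * (g1 * g1 + h * h)).
  assert (HG : 0 < G) by (unfold G; repeat apply Rmult_lt_0_compat; nra).
  assert (HtG : 0 < tau / G) by (apply Rdiv_lt_0_compat; lra).
  set (d := Rmin 1 (tau / G)).
  assert (Hd0 : 0 < d) by (apply Rmin_glb_lt; lra).
  assert (Hd1 : d <= 1) by apply Rmin_l.
  assert (Hd : G * (d * d) <= tau).
  { apply Rle_trans with (G * (tau / G)); [|right; field; lra].
    apply Rmult_le_compat_l; [lra|]. apply Rle_trans with d; [nra|apply Rmin_r]. }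
  exists d. split; [assumption|]. intros A p v _ HA Hclose Hdyn.
  set (pc := fun k => center N (p k)). set (vc := fun k => center N (v k)).
  set (m := fun k => lincomb 1 (pc k) (1 / 2) (vc k)).
  set (s := fun k => lincomb 1 (vc (S k)) 1 (vc k)).
  set (z := fun k => dot N (m k) (m k) + dot N (vc k) (vc k)).
  assert (Hm : forall k, sumN N (m k) = 0).
  { intros k. unfold m, pc, vc. rewrite sumN_lincomb, !sumN_center by lia. ring. }
  assert (Hs : forall k, sumN N (s k) = 0).
  { intros k. unfold s, vc. rewrite sumN_lincomb, !sumN_center by lia. ring. }
  assert (Hz : Un_cv z 0).
  { apply dissipated_cv_0 with (fun k => energy N L g1 h eps (m k) (vc k)) eta; auto.
    - intros k. unfold z. pose proof (dot_self_nonneg N (m k)).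
      pose proof (dot_self_nonneg N (vc k)). lra.
    - intros k. pose proof (centered_step N g1 g2 (A k) _ _ _ _ (HA k) (Hdyn k)) as Hc.
      fold (pc k) (vc k) (pc (S k)) (vc (S k)) in Hc.
      rewrite (energy_ext N L g1 h eps (m (S k)) (lincomb 1 (m k) (1 / 2) (s k))
                 (vc (S k)) (lincomb 1 (s k) (-1) (vc k))).
      + apply Hdiss; auto.
        (* In terms of [m] the feedback [g1 p + g2 v] is [g1 m + h v], so the deviation [e] is the
           difference of the two Laplacians applied to this one vector [y]. *)
        set (y := lincomb g1 (m k) h (vc k)).
        pose proof (laplacian_perturbation N A0 (A k) d y HA0 (HA k) (Hclose k)) as He.
        cbv zeta in He. fold L in He.
        match type of He with dot N ?f _ <= _ =>
          set (e := f) in He; rewrite (dot_ext N _ e _ e) by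
            (intros i Hi; destruct (Hc i Hi) as [_ Hv]; unfold e, y, s;
             rewrite !mulv_lincomb; unfold m; rewrite !mulv_lincomb; unfold lincomb;
             rewrite Hv; unfold h; field)
        end.
        apply Rle_trans with (1 := He).
        assert (Hy : dot N y y <= 2 * (g1 * g1 + h * h) * z k).
        { unfold z, y. pose proof (dot_self_nonneg N (lincomb g1 (m k) (- h) (vc k))) as H.
          rewrite !dot_lincomb_l, !dot_lincomb_r in *.
          pose proof (dot_self_nonneg N (m k)). pose proof (dot_self_nonneg N (vc k)).
          assert (0 <= h * h * dot N (m k) (m k)) by (apply Rmult_le_pos; nra).
          assert (0 <= g1 * g1 * dot N (vc k) (vc k)) by (apply Rmult_le_pos; nra). lra. }
        apply Rle_trans with (G * (d * d) * z k).
        * unfold G. apply Rle_trans with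
            (4 * (INR N * INR N) * (d * d) * (2 * (g1 * g1 + h * h) * z k)); [|right; ring].
          apply Rmult_le_compat_l; [|assumption]. repeat apply Rmult_le_pos; lra.
        * apply Rmult_le_compat_r; [|assumption]. unfold z.
          pose proof (dot_self_nonneg N (m k)). pose proof (dot_self_nonneg N (vc k)). lra.
      + intros i Hi. destruct (Hc i Hi) as [Hp _]. unfold m, s, lincomb. rewrite Hp. field.
      + intros i Hi. unfold s, lincomb. ring. }
  intros i j Hi Hj.
  assert (Hterm : forall x l, (l < N)%nat -> x l * x l <= dot N x x).
  { intros x q Hq. apply (sumN_term_le N (fun i => x i * x i)); [intros; nra|assumption]. }
  (* From [p = m - v/2] and [(x i - x j)^2 <= 4 |x|^2], the squared position gap is at most
     [8 |m|^2 + 2 |v|^2], and the velocity gap at most [4 |v|^2]; [8] covers both. *)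
  split; apply cv_0_of_sq_le with z 8; auto; try lra; intros k;
    pose proof (Hterm (m k) i Hi) as Hmi; pose proof (Hterm (m k) j Hj) as Hmj;
    pose proof (Hterm (vc k) i Hi) as Hvi; pose proof (Hterm (vc k) j Hj) as Hvj;
    pose proof (dot_self_nonneg N (m k)); pose proof (dot_self_nonneg N (vc k)); unfold z.
  - replace (p k i - p k j) with ((m k i - m k j) - (vc k i - vc k j) / 2)
      by (unfold m, lincomb, pc, vc, center; field; lra).
    set (a := m k i) in *. set (b := m k j) in *. set (c := vc k i) in *. set (e := vc k j) in *.
    pose proof (Rle_0_sqr (a - b + (c - e) / 2)). pose proof (Rle_0_sqr (a + b)).
    pose proof (Rle_0_sqr (c + e)). unfold Rsqr in *. lra.
  - replace (v k i - v k j) with (vc k i - vc k j) by (unfold vc, center; ring).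
    set (c := vc k i) in *. set (e := vc k j) in *.
    pose proof (Rle_0_sqr (c + e)). unfold Rsqr in *. lra.
Qed.
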